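(* Let $n,d\in\mathbb{N}$, $A^\star\in\mathbb{R}^{n\times n}$, $B^\star\in\mathbb{R}^{n\times d}$, let $Q\in\mathbb{R}^{n\times n}$ be symmetric positive semidefinite and $R\in\mathbb{R}^{d\times d}$ symmetric positive definite. For each $T>0$ let $P^{\star,(T)}:[0,T]\to\mathbb{R}^{n\times n}$ be the unique continuous (symmetric positive semidefinite valued) solution of $$\tfrac{\mathrm{d}}{\mathrm{d}t}P_t+(A^\star)^\top P_t+P_tA^\star-P_t(B^\star R^{-1}(B^\star)^\top)P_t+Q=0,\ t\in[0,T];\qquad P_T=0,$$ and let $K^{\star,(T)}_t=-R^{-1}(B^\star)^\top P^{\star,(T)}_t$. Consider, for $T>0$, the nondegeneracy property $$\mathrm{(ND)}_T:\qquad \{v\in\mathbb{R}^d\mid (K^{\star,(T)}_t)^\top v=0,\ \forall t\in[0,T]\}=\{0\}.$$ (1) If $(B^\star)^\top QB^\star$ is symmetric positive definite, then $\mathrm{(ND)}_T$ holds for all $T>0$. (2) Assume that the algebraic Riccati equation $(A^\star)^\top P+PA^\star-P(B^\star R^{-1}(B^\star)^\top)P+Q=0$ admits a unique maximal solution $P^\star_\infty$, which is symmetric positive definite. Let $K^\star_\infty=-R^{-1}(B^\star)^\top P^\star_\infty$. Assume that $\lim_{T\to\infty}P^{\star,(T)}_0=P^\star_\infty$ and that $K^\star_\infty(K^\star_\infty)^\top$ is symmetric positive definite. Then there exists $T_0>0$ such that $\mathrm{(ND)}_T$ holds for all $T\ge T_0$.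
   Context: Maximality of a solution of the algebraic Riccati equation is with respect to the Loewner (positive semidefinite) order on symmetric matrices. *)

(* Defs.v *)
From mathcomp Require Import all_boot all_order all_algebra.
From mathcomp Require Import all_classical all_reals all_analysis.

Set Implicit Arguments.
Unset Strict Implicit.
Unset Printing Implicit Defensive.

Import Order.TTheory GRing.Theory Num.Theory.
Import numFieldNormedType.Exports.
Local Open Scope classical_set_scope.
Local Open Scope ring_scope.

Definition sym_psd (R : realType) (n : nat) (M : 'M[R]_n) : Prop :=
  M^T = M /\ forall x : 'cV[R]_n, 0 <= (x^T *m M *m x) 0 0.

Definition sym_pd (R : realType) (n : nat) (M : 'M[R]_n) : Prop :=
  M^T = M /\ forall x : 'cV[R]_n, x != 0 -> 0 < (x^T *m M *m x) 0 0.

Definition loewner_le (R : realType) (n : nat) (X Y : 'M[R]_n) : Prop :=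
  sym_psd (Y - X).

(* Derivative of [f] at [t] relative to [D]; with [D = `[0, T]] it is the
   one-sided derivative at the endpoints. *)
Definition has_deriv_within (R : realType) (m n : nat) (D : set R)
    (f : R -> 'M[R]_(m, n)) (t : R) (df : 'M[R]_(m, n)) : Prop :=
  (s - t)^-1 *: (f s - f t) @[s --> within D t^'] --> df.

Definition riccati_op (R : realType) (n d : nat) (A : 'M[R]_n)
    (B : 'M[R]_(n, d)) (Q : 'M[R]_n) (Rc : 'M[R]_d) (P : 'M[R]_n) : 'M[R]_n :=
  A^T *m P + P *m A - P *m (B *m invmx Rc *m B^T) *m P + Q.

(* The value of [P] outside [0, T] is irrelevant. *)
Definition riccati_solution (R : realType) (n d : nat) (A : 'M[R]_n)
    (B : 'M[R]_(n, d)) (Q : 'M[R]_n) (Rc : 'M[R]_d) (T : R)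
    (P : R -> 'M[R]_n) : Prop :=
  [/\ {within `[0, T], continuous P},
      forall t : R, t \in `[0, T] -> sym_psd (P t),
      forall t : R, t \in `[0, T] -> exists2 dP : 'M[R]_n,
        has_deriv_within `[0, T] P t dP &
        dP + riccati_op A B Q Rc (P t) = 0
    & P T = 0].

(* Uniqueness is as a function on [0, T]. *)
Definition the_riccati_solution (R : realType) (n d : nat) (A : 'M[R]_n)
    (B : 'M[R]_(n, d)) (Q : 'M[R]_n) (Rc : 'M[R]_d) (T : R)
    (P : R -> 'M[R]_n) : Prop :=
  riccati_solution A B Q Rc T P /\
  forall P' : R -> 'M[R]_n, riccati_solution A B Q Rc T P' ->
    forall t : R, t \in `[0, T] -> P' t = P t.

Definition feedback_gain (R : realType) (n d : nat) (B : 'M[R]_(n, d))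
    (Rc : 'M[R]_d) (P : 'M[R]_n) : 'M[R]_(d, n) :=
  - (invmx Rc *m B^T *m P).

Definition are_solution (R : realType) (n d : nat) (A : 'M[R]_n)
    (B : 'M[R]_(n, d)) (Q : 'M[R]_n) (Rc : 'M[R]_d) (P : 'M[R]_n) : Prop :=
  P^T = P /\ riccati_op A B Q Rc P = 0.

(* A maximal element, for the Loewner order, of the set of symmetric
   solutions; a greatest solution is in particular the unique such element. *)
Definition maximal_are_solution (R : realType) (n d : nat) (A : 'M[R]_n)
    (B : 'M[R]_(n, d)) (Q : 'M[R]_n) (Rc : 'M[R]_d) (P : 'M[R]_n) : Prop :=
  are_solution A B Q Rc P /\
  forall P' : 'M[R]_n, are_solution A B Q Rc P' -> loewner_le P P' -> P' = P.

Definition nondegenerate_gain (R : realType) (n d : nat) (T : R)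
    (K : R -> 'M[R]_(d, n)) : Prop :=
  [set v : 'cV[R]_d | forall t : R, t \in `[0, T] -> (K t)^T *m v = 0] = [set 0].

(* Main.v *)
Require Import Defs.
From mathcomp Require Import all_boot all_order all_algebra.
From mathcomp Require Import all_classical all_reals all_analysis.

Set Implicit Arguments.
Unset Strict Implicit.
Unset Printing Implicit Defensive.

Import Order.TTheory GRing.Theory Num.Theory.
Import numFieldNormedType.Exports.
Local Open Scope classical_set_scope.
Local Open Scope ring_scope.

(** Write [K_t = - Rc^-1 B^T P_t], so that [K_t^T v = - P_t w] with
    [w = B Rc^-1 v], because [Rc] and [P_t] are symmetric.

    For the first part, the equation at the terminal time, where [P_T = 0],
    says that the left derivative of [P] at [T] is [- Q].  If [P_t w = 0] for
    all [t] in [[0, T]], the difference quotients of [P] at [T] all kill [w],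
    hence so does their limit: [Q w = 0] ([riccati_ker_state_cost]).  Then
    [(B^T Q B) (Rc^-1 v) = B^T (Q w) = 0], and positive definiteness of
    [B^T Q B] gives [Rc^-1 v = 0], so [v = 0].

    For the second part the time [t = 0] alone is enough.  Nondegeneracy at
    time [0] follows from [det (K_0 K_0^T) != 0] ([nondegenerate_gain_det]).
    This is an open condition on [P_0], because the determinant of the Gram
    matrix is continuous ([cvg_mulmx], [cvg_trmx], [cvg_det]); it holds at
    the limit [Pinf], hence for all large [T]. *)

Lemma cvg_mxP (R : realType) (I : Type) (F : set_system I) {FF : Filter F}
    (m n : nat) (f : I -> 'M[R]_(m, n)) (M : 'M[R]_(m, n)) :
  f x @[x --> F] --> M <-> forall i j, f x i j @[x --> F] --> M i j.
Proof.
split=> [fM i j|fM].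
  exact: (cvg_comp _ _ fM (@coord_continuous R m n i j M)).
move=> U [V MV VU]; apply: (@filterS _ F _ _ _ (fun x => VU (f x))).
apply: filter_forall => i; apply: filter_forall => j.
exact: fM (MV i j).
Qed.

Lemma cvg_mulmx (R : realType) (I : Type) (F : set_system I) {FF : Filter F}
    (m n p : nat) (f : I -> 'M[R]_(m, n)) (g : I -> 'M[R]_(n, p))
    (M : 'M[R]_(m, n)) (N : 'M[R]_(n, p)) :
  f x @[x --> F] --> M -> g x @[x --> F] --> N ->
  f x *m g x @[x --> F] --> M *m N.
Proof.
move=> /cvg_mxP fM /cvg_mxP gN; apply/cvg_mxP => i j; rewrite mxE.
under eq_fun do rewrite mxE.
apply: cvg_big => [|k _]; first exact: add_continuous.
by apply: cvgM; [exact: fM|exact: gN].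
Qed.

Lemma cvg_trmx (R : realType) (I : Type) (F : set_system I) {FF : Filter F}
    (m n : nat) (f : I -> 'M[R]_(m, n)) (M : 'M[R]_(m, n)) :
  f x @[x --> F] --> M -> (f x)^T @[x --> F] --> M^T.
Proof.
move=> /cvg_mxP fM; apply/cvg_mxP => i j; rewrite mxE.
by under eq_fun do rewrite mxE; exact: fM.
Qed.

Lemma cvg_det (R : realType) (I : Type) (F : set_system I) {FF : Filter F}
    (n : nat) (f : I -> 'M[R]_n) (M : 'M[R]_n) :
  f x @[x --> F] --> M -> \det (f x) @[x --> F] --> \det M.
Proof.
move=> /cvg_mxP fM; apply: cvg_big => [|s _]; first exact: add_continuous.
apply: cvgM; first exact: cvg_cst.
apply: cvg_big => [|i _]; last exact: fM.
exact: mul_continuous.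
Qed.

(** A linear relation [f s *m w = 0] valid on [D] can be differentiated at a
    point of [D].  Properness of the filter says that [t] is a limit point of
    [D]; at an isolated point every matrix would be a derivative of [f]. *)
Lemma deriv_within_mulmx0 (R : realType) (m n p : nat) (D : set R) (t : R)
    (f : R -> 'M[R]_(m, n)) (df : 'M[R]_(m, n)) (w : 'M[R]_(n, p)) :
  ProperFilter (within D t^') -> D t -> has_deriv_within D f t df ->
  (forall s, D s -> f s *m w = 0) -> df *m w = 0.
Proof.
move=> PF Dt fdf fw0.
have /cvg_mxP dfw : (s - t)^-1 *: (f s - f t) *m w @[s --> within D t^']
    --> df *m w.
  by apply: cvg_mulmx fdf _; exact: cvg_cst.
apply/matrixP => i j; apply: (cvg_unique _ (dfw i j)) => //.
apply: cvg_near_cst; near=> s.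
have Ds : D s by near: s; exact: withinT.
by rewrite -scalemxAl mulmxBl !fw0// subr0 scaler0.
Unshelve. all: by end_near. Qed.

Lemma within_itv_right_proper (R : realType) (a b : R) : a < b ->
  ProperFilter (within `[a, b] b^').
Proof.
move=> ab; apply: Build_ProperFilter_ex => U.
rewrite /within /= => -[e /= e0 be].
(* A point within [e] of [b] on its left, truncated at [a] to stay in the
   interval. *)
pose s := Num.max a (b - e / 2).
have sb : s < b by rewrite gt_max ab ltrBlDr ltrDl divr_gt0.
exists s; apply: be => /=.
- rewrite gtr0_norm ?subr_gt0// ltrBlDl -ltrBlDr lt_max; apply/orP; right.
  by rewrite ltrD2l ltrN2 ltr_pdivrMr// mulr_natr mulr2n ltrDl.
- by rewrite lt_eqF.
- by rewrite in_itv/= (ltW sb) le_max lexx.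
Qed.

Lemma sym_pd_unitmx (R : realType) (n : nat) (M : 'M[R]_n) :
  sym_pd M -> M \in unitmx.
Proof.
move=> [_ Mpd]; rewrite unitmxE unitfE; apply/det0P => -[v v0 vM].
have := Mpd v^T; rewrite trmx_eq0 trmxK vM mul0mx mxE ltxx.
by move=> /(_ v0).
Qed.

Lemma sym_pd_ker0 (R : realType) (n : nat) (M : 'M[R]_n) (v : 'cV[R]_n) :
  sym_pd M -> M *m v = 0 -> v = 0.
Proof. by move=> /sym_pd_unitmx uM Mv; rewrite -(mulKmx uM v) Mv mulmx0. Qed.

Lemma trmx_feedback_gain (R : realType) (n d : nat) (B : 'M[R]_(n, d))
    (Rc : 'M[R]_d) (P : 'M[R]_n) :
  Rc^T = Rc -> P^T = P ->
  (feedback_gain B Rc P)^T = - (P *m (B *m invmx Rc)).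
Proof.
by move=> RcT PT; rewrite linearN/= !trmx_mul trmx_inv RcT PT trmxK.
Qed.

Lemma nondegenerate_gainP (R : realType) (n d : nat) (T : R)
    (K : R -> 'M[R]_(d, n)) :
  (forall v : 'cV[R]_d,
    (forall t : R, t \in `[0, T] -> (K t)^T *m v = 0) -> v = 0) ->
  nondegenerate_gain T K.
Proof.
move=> K0; apply/seteqP; split=> v /=; first exact: K0.
by move=> -> t _; rewrite mulmx0.
Qed.

(** At [t = T] the terminal condition removes every term of the equation but
    [dP + Q = 0], so differentiating [P t *m w = 0] there gives [Q *m w = 0].
    *)
Lemma riccati_ker_state_cost (R : realType) (n d : nat) (A : 'M[R]_n)
    (B : 'M[R]_(n, d)) (Q : 'M[R]_n) (Rc : 'M[R]_d) (T : R)
    (P : R -> 'M[R]_n) (w : 'cV[R]_n) :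
  0 < T -> riccati_solution A B Q Rc T P ->
  (forall t : R, t \in `[0, T] -> P t *m w = 0) -> Q *m w = 0.
Proof.
move=> T0 [_ _ Pode PT] Pw.
have TT : T \in `[0, T] by rewrite in_itv/= lexx ltW.
have [dP PdP] := Pode T TT.
rewrite /riccati_op PT !(mulmx0, mul0mx) subr0 !add0r => /eqP.
rewrite addrC addr_eq0 => /eqP ->; rewrite mulNmx.
rewrite (deriv_within_mulmx0 _ _ PdP Pw) ?oppr0//.
exact: within_itv_right_proper.
Qed.

(** The common kernel over [[0, T]] lies in the kernel of [(K 0)^T], which is
    trivial as soon as the Gram matrix of the rows of [K 0] is invertible.
    The determinant form of the condition is the one that passes to nearby
    gains. *)
Lemma nondegenerate_gain_det (R : realType) (n d : nat) (T : R)
    (K : R -> 'M[R]_(d, n)) :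
  0 <= T -> \det (K 0 *m (K 0)^T) != 0 -> nondegenerate_gain T K.
Proof.
move=> T0; rewrite -unitfE -unitmxE => uK; apply: nondegenerate_gainP => v Kv.
rewrite -(mulKmx uK v) -mulmxA Kv ?mulmx0//.
by rewrite in_itv/= lexx.
Qed.

Theorem proposition2p1 (R : realType) (n d : nat)
    (A : 'M[R]_n) (B : 'M[R]_(n, d)) (Q : 'M[R]_n) (Rc : 'M[R]_d)
    (P : R -> R -> 'M[R]_n)
    (hQ : sym_psd Q) (hRc : sym_pd Rc)
    (hP : forall T : R, 0 < T -> the_riccati_solution A B Q Rc T (P T)) :
  (sym_pd (B^T *m Q *m B) ->
    forall T : R, 0 < T ->
      nondegenerate_gain T (fun t => feedback_gain B Rc (P T t)))
  /\
  (forall Pinf : 'M[R]_n,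
    unique (maximal_are_solution A B Q Rc) Pinf ->
    sym_pd Pinf ->
    P T 0 @[T --> +oo] --> Pinf ->
    sym_pd (feedback_gain B Rc Pinf *m (feedback_gain B Rc Pinf)^T) ->
    exists2 T0 : R, 0 < T0 &
      forall T : R, T0 <= T ->
        nondegenerate_gain T (fun t => feedback_gain B Rc (P T t))).
Proof.
have [RcT _] := hRc.
have uRc := sym_pd_unitmx hRc.
split=> [BQB T T0|Pinf _ _ PTP KKpd].
  have [Psol _] := hP T T0.
  have [_ Ppsd _ _] := Psol.
  apply: nondegenerate_gainP => v Kv.
  pose w := B *m (invmx Rc *m v).
  have Qw : Q *m w = 0.
    apply: (riccati_ker_state_cost T0 Psol) => t tT.
    have [Pt _] := Ppsd t tT.
    have := Kv t tT; rewrite trmx_feedback_gain// mulNmx => /eqP.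
    by rewrite oppr_eq0 => /eqP; rewrite /w !mulmxA.
  have u0 : invmx Rc *m v = 0.
    by apply: (sym_pd_ker0 BQB); rewrite -!mulmxA Qw mulmx0.
  by rewrite -(mulKVmx uRc v) u0 mulmx0.
pose gram (M : 'M[R]_n) := feedback_gain B Rc M *m (feedback_gain B Rc M)^T.
have gram_cvg : gram (P T 0) @[T --> +oo] --> gram Pinf.
  have Kcvg :
      feedback_gain B Rc (P T 0) @[T --> +oo] --> feedback_gain B Rc Pinf.
    rewrite /feedback_gain -mulNmx; under eq_fun do rewrite -mulNmx.
    exact: cvg_mulmx (cvg_cst _) PTP.
  exact: cvg_mulmx Kcvg (cvg_trmx Kcvg).
have gram0 : \det (gram Pinf) != 0 by rewrite -unitfE -unitmxE sym_pd_unitmx.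
have [M [_ MP]] := cvgr_neq0 _ (cvg_det gram_cvg) gram0.
(* The neighbourhood of [+oo] contains the ray of points [T > M], with [M] of
   any sign, while [T0] must be positive and satisfy the bound itself. *)
exists (Num.max M 0 + 1) => [|T TM].
  by rewrite ltr_wpDl// le_max lexx orbT.
have : Num.max M 0 < T by rewrite (lt_le_trans _ TM)// ltrDl.
rewrite gt_max => /andP[MT T0].
by apply: nondegenerate_gain_det; [exact: ltW|exact: MP].
Qed.
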